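(* Let $\mathcal{A}=(a_{ijk})$ be a 3rd order 3-dimensional real symmetric tensor with all entries $a_{ijk}\in\{-1,0,1\}$. Suppose that $r,s,t\in\{1,2,3\}$ are such that $r\neq s$, $s\neq t$, $r\neq t$ and $$a_{rss}=a_{rtt}=1,\qquad a_{123}=0.$$ Then $\mathcal{A}$ is strictly copositive if and only if $a_{iii}=1$ and $a_{iij}+a_{ijj}\ge 0$ for all $i,j\in\{1,2,3\}$ with $i\neq j$, and $$a_{rrs}+a_{rrt}\ge -1.$$
   Context: A 3rd order 3-dimensional real symmetric tensor is an array $\mathcal{A}=(a_{ijk})_{1\le i,j,k\le 3}$ of real numbers whose entries are invariant under every permutation of the indices. For $x=(x_1,x_2,x_3)^\top\in\mathbb{R}^3$ put $\mathcal{A}x^3=\sum_{i,j,k=1}^3 a_{ijk}x_ix_jx_k$. $\mathcal{A}$ is strictly copositive if $\mathcal{A}x^3>0$ for every $x\neq 0$ with $x_1,x_2,x_3\ge 0$. *)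

(* Defs.v *)
From mathcomp Require Import all_boot all_order all_algebra all_fingroup.
From mathcomp Require Import reals.
Set Implicit Arguments. Unset Strict Implicit. Unset Printing Implicit Defensive.
Import Order.TTheory GRing.Theory Num.Theory.
Local Open Scope ring_scope.

(* Indices run over 'I_3 = {0, 1, 2}: the mathematical indices 1, 2, 3 are shifted down by one. *)
Definition tensor3 (R : Type) : Type := 'I_3 -> 'I_3 -> 'I_3 -> R.

(* idx lists the three indices of an entry, sigma rearranges their positions. *)
Definition tsymmetric (R : Type) (A : tensor3 R) : Prop :=
  forall (idx : 'I_3 -> 'I_3) (sigma : 'S_3),
    A (idx (sigma 0)) (idx (sigma 1)) (idx (sigma 2)) =
    A (idx 0) (idx 1) (idx 2).

Definition tform (R : realType) (A : tensor3 R) (x : 'cV[R]_3) : R :=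
  \sum_i \sum_j \sum_k A i j k * x i 0 * x j 0 * x k 0.

Definition strictly_copositive (R : realType) (A : tensor3 R) : Prop :=
  forall x : 'cV[R]_3, x != 0 -> (forall i, 0 <= x i 0) -> 0 < tform A x.

(* Main.v *)
Require Import Defs.
From mathcomp Require Import all_boot all_order all_algebra all_fingroup.
From mathcomp Require Import reals ring lra.
Set Implicit Arguments. Unset Strict Implicit. Unset Printing Implicit Defensive.
Import Order.TTheory GRing.Theory Num.Theory.
Local Open Scope ring_scope.

(** Write [x, y, z] for the coordinates along [r, s, t]. When the diagonal
    entries are 1, the form is [x * Q x y z + G y z] with
    [Q = x^2 + 3 p x y + 3 q x z + 3 y^2 + 3 z^2], [p = a_rrs], [q = a_rrt], and
    [G] the binary cubic form of the face [x = 0]. If [p + q >= -1], then at most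
    one of [p, q] is [-1] and [Q >= 0] on the orthant; [G > 0] away from the
    origin because [a_sst + a_stt >= 0]. Conversely, the points [e_i], [e_i + e_j]
    and [3 e_r + e_s + e_t] give the necessary conditions. *)

Section TernaryIndices.
Variables (r s t : 'I_3).
Hypotheses (hrs : r != s) (hst : s != t) (hrt : r != t).

(** A duplicate-free list of length 3 inside the enumeration of ['I_3], which also has size 3, must
    exhaust it. *)
Lemma ord3_cases (i : 'I_3) : [\/ i = r, i = s | i = t].
Proof.
have : i \in [:: r; s; t].
  have u : uniq [:: r; s; t] by rewrite /= !inE negb_or hrs hrt hst.
  have sub : {subset [:: r; s; t] <= enum 'I_3} by move=> k _; rewrite mem_enum.
  have [|_ ->] := uniq_min_size u sub; last by rewrite mem_enum.
  by rewrite size_enum_ord.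
by rewrite !inE => /or3P[] /eqP ->; [constructor 1 | constructor 2 | constructor 3].
Qed.

Lemma sum_ord3 (V : nmodType) (f : 'I_3 -> V) : \sum_i f i = f r + f s + f t.
Proof.
rewrite (bigD1 r) //= (bigD1 s) 1?eq_sym //= (big_pred1 t) ?addrA // => i.
case: (ord3_cases i) => -> /=; rewrite !eqxx ?(negbTE hrt) ?(negbTE hst) //=.
  by rewrite andbF.
by rewrite ![t == _]eq_sym (negbTE hrt) (negbTE hst).
Qed.

End TernaryIndices.

Section SymmetricTensor.
Variables (R : realType) (A : tensor3 R).
Hypothesis Asym : tsymmetric A.

Lemma tsymmetric_swap12 i j k : A i j k = A j i k.
Proof.
(* The default [i] of [nth] is never reached, since [l < 3]. *)
have := Asym (fun l => nth i [:: j; i; k] l) (tperm 0 1).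
by rewrite tpermL tpermR tpermD.
Qed.

Lemma tsymmetric_swap23 i j k : A i j k = A i k j.
Proof.
have := Asym (fun l => nth i [:: i; k; j] l) (tperm 1 (2 : 'I_3)).
by rewrite tpermL tpermR tpermD.
Qed.

(** The two adjacent swaps generate all rearrangements of three positions, so each of the six orders
    reduces to [0, 1, 2]. *)
Lemma tsymmetric_distinct (r s t : 'I_3) :
  r != s -> s != t -> r != t -> A r s t = A 0 1 2.
Proof.
have c (i : 'I_3) : [\/ i = 0, i = 1 | i = 2] by exact: ord3_cases.
case: (c r) => ->; case: (c s) => ->; case: (c t) => -> // _ _ _.
- exact: tsymmetric_swap23.
- exact: tsymmetric_swap12.
- by rewrite tsymmetric_swap23 tsymmetric_swap12.
- by rewrite tsymmetric_swap12 tsymmetric_swap23.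
- by rewrite tsymmetric_swap12 tsymmetric_swap23 tsymmetric_swap12.
Qed.

(** The 27 terms are grouped by the multiset of their indices, whose orderings number 1, 3 or 6. *)
Lemma tform_ternary (r s t : 'I_3) (x : 'cV[R]_3) :
  r != s -> s != t -> r != t ->
  tform A x =
    A r r r * x r 0 ^+ 3 + A s s s * x s 0 ^+ 3 + A t t t * x t 0 ^+ 3
    + 3 * (A r r s * x r 0 ^+ 2 * x s 0 + A r s s * x r 0 * x s 0 ^+ 2
         + A r r t * x r 0 ^+ 2 * x t 0 + A r t t * x r 0 * x t 0 ^+ 2
         + A s s t * x s 0 ^+ 2 * x t 0 + A s t t * x s 0 * x t 0 ^+ 2)
    + 6 * A r s t * x r 0 * x s 0 * x t 0.
Proof.
move=> hrs hst hrt.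
rewrite /tform !(sum_ord3 hrs hst hrt).
have iij i j : (A i j i = A i i j) * (A j i i = A i i j).
  by rewrite (tsymmetric_swap12 j) (tsymmetric_swap23 i j).
have ijj i j : (A j i j = A i j j) * (A j j i = A i j j).
  by rewrite (tsymmetric_swap23 j j) (tsymmetric_swap12 j i).
have rst : (A r t s = A r s t) * (A s r t = A r s t) * (A s t r = A r s t)
    * (A t r s = A r s t) * (A t s r = A r s t).
  by do !split; rewrite !tsymmetric_distinct // eq_sym.
rewrite !(iij r s, iij r t, iij s t, ijj r s, ijj r t, ijj s t, rst).
ring.
Qed.

End SymmetricTensor.

Section SignCubics.
Variable R : realType.
Implicit Types x y z p q u v : R.

Lemma sign_cases x : x \in [:: -1; 0; 1] -> [\/ x = -1, x = 0 | x = 1].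
Proof. by rewrite !inE => /or3P[] /eqP ->; [constructor 1 | constructor 2 | constructor 3]. Qed.

(* For [(u, v) = (-1, 1)] the cubic is [y (y^2 - 3 y z + 3 z^2) + z^3], whose
   quadratic factor is nonnegative; [(1, -1)] is the mirror image. *)
Lemma binary_sign_cubic_gt0 u v y z :
  u \in [:: -1; 0; 1] -> v \in [:: -1; 0; 1] -> 0 <= u + v ->
  0 <= y -> 0 <= z -> 0 < y + z ->
  0 < y ^+ 3 + z ^+ 3 + 3 * (u * y ^+ 2 * z + v * y * z ^+ 2).
Proof.
move=> hu hv huv y0 z0 yz0.
have cube (a b : R) : 0 <= a -> 0 <= b -> 0 < a + b ->
    0 < a * (a ^+ 2 - 3 * a * b + 3 * b ^+ 2) + b ^+ 3.
  move=> a0 b0 ab.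
  (* Strict positivity comes from [a ^+ 3] when [b = 0], and from [b ^+ 3] otherwise. *)
  have [b_eq0|b_gt0] : b = 0 \/ 0 < b by move: b0; rewrite le0r => /orP[/eqP|]; auto.
    have a_gt0 : 0 < a by lra.
    have := exprn_gt0 3 a_gt0; rewrite b_eq0; lra.
  apply: ltr_wpDl; last exact: exprn_gt0.
  (* Here [a^2 - 3ab + 3b^2 = (a - 3/2 b)^2 + 3/4 b^2]. *)
  by apply: mulr_ge0 => //; have := sqr_ge0 (a - 3 / 2 * b); have := sqr_ge0 b; nra.
have c1 := cube y z y0 z0 yz0.
have c2 := cube z y z0 y0 ltac:(lra).
(* Apart from the two mixed pairs settled by [c1] and [c2], both [u] and [v] are nonnegative, and
   [y^3 + z^3] supplies the strict sign. *)
have y2z : 0 <= y ^+ 2 * z by rewrite mulr_ge0 ?sqr_ge0.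
have yz2 : 0 <= y * z ^+ 2 by rewrite mulr_ge0 ?sqr_ge0.
have p3 : 0 < y ^+ 3 + z ^+ 3.
  have [y_eq0|y_gt0] : y = 0 \/ 0 < y by move: y0; rewrite le0r => /orP[/eqP|]; auto.
    have z_gt0 : 0 < z by lra.
    by rewrite y_eq0 expr0n add0r exprn_gt0.
  by rewrite ltr_pwDl ?exprn_gt0 ?exprn_ge0.
case: (sign_cases hu) huv => ->; case: (sign_cases hv) => -> huv; try lra.
Qed.

(** At most one of [p], [q] is -1. If [p = -1], the negative cross term is absorbed by [x^2 - 3xy +
    3y^2 = (x - 3/2 y)^2 + 3/4 y^2], and the term in [q] is nonnegative; the case [q = -1] is
    symmetric. *)
Lemma ternary_sign_quadratic_ge0 p q x y z :
  p \in [:: -1; 0; 1] -> q \in [:: -1; 0; 1] -> -1 <= p + q ->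
  0 <= x -> 0 <= y -> 0 <= z ->
  0 <= x ^+ 2 + 3 * p * x * y + 3 * q * x * z + 3 * y ^+ 2 + 3 * z ^+ 2.
Proof.
move=> hp hq hpq x0 y0 z0.
have xy := mulr_ge0 x0 y0; have xz := mulr_ge0 x0 z0.
have sy := sqr_ge0 (x - 3 / 2 * y); have sz := sqr_ge0 (x - 3 / 2 * z).
have x2 := sqr_ge0 x; have y2 := sqr_ge0 y; have z2 := sqr_ge0 z.
by case: (sign_cases hp) hpq => ->; case: (sign_cases hq) => -> hpq; lra.
Qed.

End SignCubics.

Theorem theorem3p2 (R : realType) (A : tensor3 R) (r s t : 'I_3)
    (Asym : tsymmetric A)
    (Aentries : forall i j k, A i j k \in [:: -1; 0; 1])
    (hrs : r != s) (hst : s != t) (hrt : r != t)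
    (hrss : A r s s = 1) (hrtt : A r t t = 1) (h123 : A 0 1 2 = 0) :
  strictly_copositive A <->
  [/\ forall i, A i i i = 1,
      forall i j, i != j -> 0 <= A i i j + A i j j
    & -1 <= A r r s + A r r t].
Proof.
have Asgn i j k := sign_cases (Aentries i j k).
have Arst : A r s t = 0 by rewrite (tsymmetric_distinct Asym).
(* A set of two indices cannot cover ['I_3]. *)
have third (i j : 'I_3) : i != j -> exists2 k, i != k & j != k.
  move=> hij; have : [exists k, (i != k) && (j != k)].
    apply: contraT; rewrite negb_exists => /forallP h.
    have : (#|'I_3| <= #|[set i; j]|)%N.
      apply/subset_leq_card/subsetP => k _.
      by move: (h k); rewrite !inE negb_and !negbK ![_ == k]eq_sym.
    by rewrite card_ord cards2 hij.
  by move=> /existsP[k /andP[]]; exists k.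
split=> [cop|[diag pairs rpair] x x_neq0 x_ge0].
  (* Copositivity at the point with coordinates [a, b, c] along [i, j, k]; [a > 0] makes it
     nonzero. *)
  have pos (i j k : 'I_3) (a b c : R) : i != j -> j != k -> i != k ->
      0 < a -> 0 <= b -> 0 <= c ->
      0 < A i i i * a ^+ 3 + A j j j * b ^+ 3 + A k k k * c ^+ 3
        + 3 * (A i i j * a ^+ 2 * b + A i j j * a * b ^+ 2
             + A i i k * a ^+ 2 * c + A i k k * a * c ^+ 2
             + A j j k * b ^+ 2 * c + A j k k * b * c ^+ 2)
        + 6 * A i j k * a * b * c.
    move=> hij hjk hik a0 b0 c0.
    pose x : 'cV[R]_3 := \col_l (if l == i then a else if l == j then b else c).
    have xi : x i 0 = a by rewrite mxE eqxx.
    have xj : x j 0 = b by rewrite mxE [j == i]eq_sym (negbTE hij) eqxx.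
    have xk : x k 0 = c by rewrite mxE ![k == _]eq_sym (negbTE hik) (negbTE hjk).
    have := cop x; rewrite (tform_ternary Asym _ hij hjk hik) xi xj xk; apply.
      by apply/eqP => x0; move: xi a0; rewrite x0 mxE => <-; rewrite ltxx.
    by move=> l; rewrite mxE; case: ifP => _; [exact: ltW | case: ifP].
  have diag i : A i i i = 1.
    have [j hij] : exists j, i != j.
      by case: (altP (i =P 0)) => [->|]; [exists 1 | exists 0].
    have [k hik hjk] := third _ _ hij.
    have := pos i j k 1 0 0 hij hjk hik ltr01 (lexx 0) (lexx 0).
    by case: (Asgn i i i) => ->; lra.
  split=> // [i j hij|].
    have [k hik hjk] := third _ _ hij.
    (* The value is [2 + 3 (a_iij + a_ijj)]; the bracket is an integer above -2/3, hence
       nonnegative. *)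
    have := pos i j k 1 1 0 hij hjk hik ltr01 ler01 (lexx 0).
    rewrite !diag.
    by case: (Asgn i i j) => ->; case: (Asgn i j j) => ->; lra.
  (* The value is [47 + 27 (a_rrs + a_rrt) + 3 (a_sst + a_stt)]. If [a_rrs = a_rrt = -1], it is at
     most [47 - 54 + 6 = -1], whatever the last two entries are. *)
  have := pos r s t 3 1 1 hrs hst hrt ltac:(lra) ler01 ler01.
  rewrite !diag hrss hrtt Arst.
  by case: (Asgn r r s) => ->; case: (Asgn r r t) => ->;
     case: (Asgn s s t) => ->; case: (Asgn s t t) => ->; lra.
rewrite (tform_ternary Asym _ hrs hst hrt) !diag hrss hrtt Arst.
have Q_ge0 := ternary_sign_quadratic_ge0 (Aentries r r s) (Aentries r r t)
  rpair (x_ge0 r) (x_ge0 s) (x_ge0 t).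
have xQ_ge0 := mulr_ge0 (x_ge0 r) Q_ge0.
(* Off the [r] axis, [G] is strictly positive and [x * Q] is nonnegative; on the axis the form
   reduces to the cube of the [r] coordinate. *)
have [st_gt0|st_le0] := ltP 0 (x s 0 + x t 0).
  have G_gt0 := binary_sign_cubic_gt0 (Aentries s s t) (Aentries s t t)
    (pairs s t hst) (x_ge0 s) (x_ge0 t) st_gt0.
  lra.
have xs0 : x s 0 = 0 by have := x_ge0 s; have := x_ge0 t; lra.
have xt0 : x t 0 = 0 by have := x_ge0 s; have := x_ge0 t; lra.
have xr_gt0 : 0 < x r 0.
  rewrite lt0r x_ge0 andbT; apply: contraNneq x_neq0 => xr0.
  apply/eqP/colP => i; rewrite mxE.
  by case: (ord3_cases hrs hst hrt i) => ->.
have := exprn_gt0 3 xr_gt0; rewrite xs0 xt0; lra.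
Qed.
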